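(* Let $g:(0,\infty)\to\mathbb{R}$ satisfy $g(1/\mathcal{Z})=-g(\mathcal{Z})$ for all $\mathcal{Z}>0$. For $B\in\mathrm{Sym}^{++}(3)$ with $V=\sqrt{B}$ let $\mathbb{A}^{\circ}(B):\mathrm{Sym}(3)\to\mathrm{Sym}(3)$ be $$\mathbb{A}^{\circ}(B).D = B D + D B+\sum_{\substack{\mu,\nu\in\mathrm{spec}(V)\\ \mu\neq\nu}} g(\mu/\nu)\,(\mu^2-\nu^2)\,P_\mu\, D\, P_\nu ,$$ where $\mathrm{spec}(V)$ is the set of distinct eigenvalues of $V$ and $P_\mu$ is the orthogonal projection onto the eigenspace of $V$ for $\mu$. Define $\overline g(\mathcal{Z}):=\mathcal{Z}^2+1+g(\mathcal{Z})\,(\mathcal{Z}^2-1)$ for $\mathcal{Z}>0$. Then: (i) the associated corotational rate is positive, i.e. $\langle\mathbb{A}^{\circ}(B).D,D\rangle>0$ for all $B\in\mathrm{Sym}^{++}(3)$ and all $D\in\mathrm{Sym}(3)\setminus\{0\}$, if and only if $\overline g(\mathcal{Z})>0$ for all $\mathcal{Z}>0$; (ii) $\mathbb{A}^{\circ}(B)$ is invertible for all $B\in\mathrm{Sym}^{++}(3)$ if and only if $\overline g(\mathcal{Z})\neq0$ for all $\mathcal{Z}>0$.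
   Context: $\mathrm{Sym}(3)$ denotes the real symmetric $3\times3$ matrices, $\mathrm{Sym}^{++}(3)$ the positive definite ones, $\langle X,Y\rangle=\mathrm{tr}(XY^T)$. In the mechanical setting, $F$ is the deformation gradient of a motion, $B=FF^T=V^2$, $L=\dot F F^{-1}$, $D=\frac12(L+L^T)$, $W=\frac12(L-L^T)$. The associated corotational rate is $\frac{\mathrm{D}^{\circ}}{\mathrm{D}t}[B]=\frac{\mathrm{D}}{\mathrm{D}t}[B]-\Omega^{\circ}B+B\Omega^{\circ}$ with skew-symmetric spin $\Omega^{\circ}=W+\sum_{\mu\neq\nu}g(\mu/\nu)P_\mu D P_\nu$ (sum over distinct eigenvalues of $V$), and $\frac{\mathrm{D}^{\circ}}{\mathrm{D}t}[B]=\mathbb{A}^{\circ}(B).D$. The sum is zero if $V$ has only one distinct eigenvalue. *)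

(* Defs.v *)
From mathcomp Require Import all_boot all_order all_algebra.
From mathcomp Require Import all_classical all_reals.

Set Implicit Arguments.
Unset Strict Implicit.
Unset Printing Implicit Defensive.

Import Order.TTheory GRing.Theory Num.Theory.

Local Open Scope classical_set_scope.
Local Open Scope ring_scope.

Definition Sym (R : realType) (n : nat) : set 'M[R]_n := [set X | X^T = X].

Definition SymPD (R : realType) (n : nat) : set 'M[R]_n :=
  [set X | Sym X /\ forall x : 'cV[R]_n, x != 0 -> 0 < (x^T *m X *m x) 0 0].

Definition inner (R : realType) (n : nat) (X Y : 'M[R]_n) : R := \tr (X *m Y^T).

(* The symmetric positive definite square root; it exists and is unique for
   B in SymPD, and the default value 0 is only reached outside SymPD. *)
Definition sqrtmx (R : realType) (n : nat) (B : 'M[R]_n) : 'M[R]_n :=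
  xget 0 [set V | SymPD V /\ V *m V = B].

Definition spec (R : realType) (n : nat) (V : 'M[R]_n) : set R :=
  [set mu | eigenvalue V mu].

(* [eigenspace V mu] is a space of row vectors and [proj_mx] acts on row vectors
   from the right; [kermx E^T] is the orthogonal complement of the row space of
   E. For symmetric V these are the usual column eigenvectors transposed, and
   the matrix of an orthogonal projection is symmetric, so the resulting matrix
   is also the orthogonal projection acting on columns. *)
Definition eigproj (R : realType) (n : nat) (V : 'M[R]_n) (mu : R) : 'M[R]_n :=
  let E := eigenspace V mu in proj_mx E (kermx E^T).

(* [g] is only ever evaluated at quotients of eigenvalues of a positive definite
   matrix, so its values outside (0, +oo) are irrelevant. The sums range over
   finite sets. *)
Definition corot (R : realType) (n : nat) (g : R -> R) (B D : 'M[R]_n) :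
    'M[R]_n :=
  let V := sqrtmx B in
  B *m D + D *m B +
  \sum_(mu \in spec V) \sum_(nu \in spec V `\ mu)
    (g (mu / nu) * (mu ^+ 2 - nu ^+ 2)) *: (eigproj V mu *m D *m eigproj V nu).

Definition gbar (R : realType) (g : R -> R) (Z : R) : R :=
  Z ^+ 2 + 1 + g Z * (Z ^+ 2 - 1).

(* Main.v *)
Require Import Defs.
From mathcomp Require Import all_boot all_order all_algebra.
From mathcomp Require Import complex.
From mathcomp Require Import ring.
From mathcomp Require Import all_classical all_reals.

Set Implicit Arguments.
Unset Strict Implicit.
Unset Printing Implicit Defensive.

Import Order.TTheory GRing.Theory Num.Theory.

Local Open Scope classical_set_scope.
Local Open Scope ring_scope.

(** Let [V] be the square root of [B]. By the spectral theorem
    ([symmetric_diag]), [V = Q^T diag(v) Q] with [Q] orthogonal and all [v_i > 0].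
    Read in the basis given by [Q], the operator [A(B)] acts entry by entry
    ([corot_orth_diag]): it multiplies the entry [(i, j)] of [D] by
    [H_ij = v_j^2 gbar(v_i/v_j)]. The oddness of [g] under inversion makes [H]
    symmetric ([corot_mult_sym]), so this is a diagonal operator on the space of
    symmetric matrices.

    Such an entrywise operator is positive if and only if all [H_ij] are
    positive ([schur_pos]), and bijective if and only if none of them vanishes
    ([schur_bij]). Conjugation by [Q] is an isometry of the symmetric matrices, so
    both equivalences hold for [A(B)] itself. As [v_j^2 > 0], the sign and the
    vanishing of [H_ij] are those of [gbar(v_i/v_j)], which gives the sufficiency
    of both conditions on gbar. For their necessity, every [Z > 0] has to occur as
    a quotient of eigenvalues of some [V]; [B = diag(Z^2, 1, 1)] achieves it
    ([corot_spectral_ratio]). *)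

(** * Spectral theorem for real symmetric matrices *)

Lemma mulmx_trE (R : comNzRingType) (m n p : nat) (A : 'M[R]_(m, n))
    (B : 'M[R]_(p, n)) i j :
  (A *m B^T) i j = \sum_k A i k * B j k.
Proof. by rewrite mxE; apply: eq_bigr => k _; rewrite mxE. Qed.

Lemma rV_sqnorm_gt0 (R : realType) (n : nat) (u : 'rV[R]_n) :
  u != 0 -> 0 < (u *m u^T) 0 0.
Proof.
move=> u0; rewrite mulmx_trE lt0r sumr_ge0 ?andbT; last first.
  by move=> k _; rewrite -expr2 sqr_ge0.
apply: contra u0; rewrite psumr_eq0; last first.
  by move=> k _; rewrite -expr2 sqr_ge0.
move=> /allP h; apply/eqP/rowP => k.
have := h k (mem_index_enum k); rewrite /= mulf_eq0 orbb => /eqP ->.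
by rewrite mxE.
Qed.

Lemma orth_row_neq0 (R : realType) (n : nat) (Q : 'M[R]_n) (i : 'I_n) :
  Q *m Q^T = 1%:M -> row i Q != 0.
Proof.
move=> QQ; apply/eqP => /rowP ri0.
have : (Q *m Q^T) i i = 0.
  rewrite mulmx_trE big1// => k _.
  by have := ri0 k; rewrite !mxE => ->; rewrite mul0r.
by rewrite QQ mxE eqxx => /eqP; rewrite oner_eq0.
Qed.

(** The characteristic polynomial has a complex root [z], with a complex
    eigenvector [v]. Since [A] is real and symmetric, computing [v A v*] from
    either side gives [z |v|^2 = conj z |v|^2], so [z] is real; and a real number
    that is an eigenvalue over the complex numbers is one over the reals. *)
Lemma symmetric_eigenvalue (R : realType) (n : nat) (A : 'M[R]_n.+1) :
  A^T = A -> exists a, eigenvalue A a.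
Proof.
move=> symA; pose Ac := map_mx (real_complex R) A.
have /closed_rootP [z] : size (char_poly Ac) != 1%N by rewrite size_char_poly.
rewrite -eigenvalue_root_char => zev.
have [v vA v0] := eigenvalueP zev.
pose vs : 'cV[R[i]]_n.+1 := (map_mx Num.conj v)^T.
have Avs : Ac *m vs = (z^*)%R *: vs.
  apply: trmx_inj; rewrite trmx_mul trmxK linearZ /= trmxK.
  have -> : Ac^T = map_mx Num.conj Ac.
    apply/matrixP => i j; rewrite !mxE.
    have /matrixP/(_ i j) := symA; rewrite mxE => ->.
    by rewrite /Num.conj /= oppr0.
  by rewrite -map_mxM vA map_mxZ.
have vvs : (v *m vs) 0 0 != 0.
  rewrite mxE; under eq_bigr do rewrite !mxE.
  apply: contra v0; rewrite psumr_eq0; last by move=> k _; rewrite mul_conjC_ge0.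
  move=> /allP h; apply/eqP/rowP => k.
  have := h k (mem_index_enum k); rewrite /= mul_conjC_eq0 => /eqP ->.
  by rewrite mxE.
have zr : (z^*)%R = z.
  have : z *: (v *m vs) = (z^*)%R *: (v *m vs).
    by rewrite scalemxAl -vA -mulmxA Avs scalemxAr.
  move=> /matrixP/(_ 0 0); rewrite [LHS]mxE [RHS]mxE => h.
  exact: esym (mulIf vvs h).
have /complex_realP [a az] : z \is Num.real by rewrite CrealE zr.
by exists a; rewrite -(eigenvalue_map (real_complex R)) -/Ac /= -az.
Qed.

(** For [u] different from [e], [Q] is the reflection in the hyperplane
    orthogonal to [u - e], which exchanges the two unit vectors. *)
Lemma householder (R : realType) (n : nat) (e u : 'rV[R]_n) :
  e *m e^T = 1%:M -> u *m u^T = 1%:M ->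
  exists Q : 'M[R]_n, Q *m Q^T = 1%:M /\ e *m Q = u.
Proof.
move=> ee uu; have [->|neq] := eqVneq u e.
  by exists 1%:M; rewrite trmx1 !mulmx1.
pose w := u - e; pose t := (e *m u^T) 0 0.
have eu : e *m u^T = t%:M by rewrite [LHS]mx11_scalar.
have ue : u *m e^T = t%:M by rewrite -[LHS]trmxK trmx_mul trmxK eu tr_scalar_mx.
have ew : e *m w^T = (t - 1)%:M.
  by rewrite /w linearB /= mulmxBr eu ee raddfB.
have ww : w *m w^T = (2 - 2 * t)%:M.
  rewrite {1}/w mulmxBl ew /w linearB /= mulmxBr uu ue -!raddfB /=.
  by congr (_%:M); ring.
have s0 : 2 - 2 * t != 0.
  have : 0 < (w *m w^T) 0 0 by rewrite rV_sqnorm_gt0// subr_eq0.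
  by rewrite ww mxE eqxx mulr1n => /lt0r_neq0.
pose c := 2 / (2 - 2 * t).
have QT : (1%:M - c *: (w^T *m w))^T = 1%:M - c *: (w^T *m w).
  by rewrite linearB linearZ /= tr_scalar_mx trmx_mul trmxK.
exists (1%:M - c *: (w^T *m w)); split.
  rewrite QT mulmxBr mulmx1 mulmxBl mul1mx -scalemxAl -scalemxAr.
  rewrite -mulmxA (mulmxA w) ww mul_scalar_mx -scalemxAr !scalerA.
  rewrite (_ : c * _ = c + c) ?scalerDl; last by rewrite /c; field.
  by rewrite opprB addrK subrK.
rewrite mulmxBr mulmx1 -scalemxAr mulmxA ew mul_scalar_mx scalerA.
rewrite (_ : c * _ = -1); last by rewrite /c; field.
by rewrite scaleN1r opprK addrC subrK.
Qed.

(** Induction on the size: an orthogonal matrix whose first row is a unit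
    eigenvector, as [householder] provides, conjugates [A] to a matrix whose first
    row and, by symmetry, first column vanish off the diagonal. *)
Lemma symmetric_diag (R : realType) (n : nat) (A : 'M[R]_n) :
  A^T = A -> exists (Q : 'M[R]_n) (d : 'rV[R]_n),
    Q *m Q^T = 1%:M /\ A = Q^T *m diag_mx d *m Q.
Proof.
elim: n A => [|n IHn] A symA.
  by exists 1%:M, 0; split; apply/matrixP => -[].
have [a /eigenvalueP[v vA v0]] := @symmetric_eigenvalue R n A symA.
have := rV_sqnorm_gt0 v0; set p := (v *m v^T) 0 0 => p0.
have vv : v *m v^T = p%:M by rewrite [LHS]mx11_scalar.
pose u := (Num.sqrt p)^-1 *: v.
have uu : u *m u^T = 1%:M.
  rewrite /u linearZ /= -scalemxAl -scalemxAr scalerA vv.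
  rewrite scale_scalar_mx -expr2 exprVn sqr_sqrtr ?(ltW p0)//.
  by rewrite mulVf// gt_eqF.
have uA : u *m A = a *: u by rewrite /u -scalemxAl vA !scalerA mulrC.
pose e := delta_mx 0 0 : 'rV[R]_(1 + n).
have ee : e *m e^T = 1%:M.
  by rewrite trmx_delta mul_delta_mx; apply/matrixP => i j; rewrite !mxE !ord1.
have [Q [QQ eQ]] := @householder R _ e u ee uu.
have QTQ : Q^T *m Q = 1%:M by exact: mulmx1C.
(* [A'] is kept opaque so that [mxE] does not expand it into a product. *)
have [A' A'def] : exists A' : 'M_(1 + n), A' = Q *m A *m Q^T.
  by exists (Q *m A *m Q^T).
have symA' : A'^T = A' by rewrite A'def !trmx_mul trmxK symA mulmxA.
have eA' : e *m A' = a *: e.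
  by rewrite A'def !mulmxA eQ uA -scalemxAl -eQ -mulmxA QQ mulmx1.
have rowA' j : A' 0 j = a * (j == 0)%:R.
  by have /matrixP/(_ 0 j) := eA'; rewrite -rowE !mxE.
pose M := drsubmx A'.
have symM : M^T = M by rewrite /M trmx_drsub symA'.
have [P [d [PP Md]]] := IHn M symM.
have A'E : A' = block_mx a%:M 0 0 M.
  have l0 : lshift n 0 = 0 :> 'I_(1 + n) by apply: val_inj.
  rewrite -[LHS]submxK -/M; congr block_mx; apply/matrixP => i j.
  - by rewrite !ord1 !mxE l0 rowA' mulr1 mulr1n.
  - by rewrite !ord1 !mxE l0 rowA' mulr0.
  - by rewrite !ord1 -symA' !mxE l0 rowA' mulr0.
pose P1 : 'M_(1 + n) := block_mx 1%:M 0 0 P.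
have P1T : P1^T = block_mx 1%:M 0 0 P^T.
  by rewrite tr_block_mx !trmx0 trmx1.
have P1P1 : P1 *m P1^T = 1%:M.
  rewrite P1T mulmx_block !(mulmx0, mul0mx, addr0, add0r).
  by rewrite mulmx1 PP -scalar_mx_block.
have A'd : A' = P1^T *m diag_mx (row_mx a%:M d) *m P1.
  rewrite A'E P1T diag_mx_row !mulmx_block !(mulmx0, mul0mx, addr0, add0r).
  rewrite -Md mulmx1 mul1mx; congr block_mx.
  by apply/matrixP => i j; rewrite !ord1 !mxE eqxx !mulr1n.
exists (P1 *m Q), (row_mx a%:M d); split.
  by rewrite trmx_mul mulmxA -(mulmxA P1) QQ mulmx1.
have -> : A = Q^T *m A' *m Q.
  by rewrite A'def !mulmxA QTQ mul1mx -mulmxA QTQ mulmx1.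
by rewrite A'd trmx_mul !mulmxA.
Qed.

(** * Spectrum and spectral projections of an orthogonally diagonalized matrix *)

Lemma eigenvalue_orth_diag (R : realType) (n : nat) (Q : 'M[R]_n)
    (d : 'rV[R]_n) (mu : R) : Q *m Q^T = 1%:M ->
  eigenvalue (Q^T *m diag_mx d *m Q) mu <-> exists i, d 0 i = mu.
Proof.
move=> QQ; have QTQ : Q^T *m Q = 1%:M by exact: mulmx1C.
split=> [/eigenvalueP[x xA x0]|[i <-]].
  pose y := x *m Q^T.
  have yd : y *m diag_mx d = mu *: y.
    by rewrite /y scalemxAl -xA !mulmxA -(mulmxA _ Q) QQ mulmx1.
  have /rV0Pn [i yi] : y != 0.
    apply: contra x0 => /eqP y0.
    by rewrite -[x]mulmx1 -QTQ mulmxA -/y y0 mul0mx.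
  exists i; have /rowP/(_ i) := yd.
  by rewrite mul_mx_diag [LHS]mxE [RHS]mxE mulrC => h; exact: (mulIf yi h).
apply/eigenvalueP; exists (row i Q).
  rewrite rowE !mulmxA -(mulmxA _ Q) QQ mulmx1 scalemxAl.
  congr (_ *m _); apply/rowP => j; rewrite mul_mx_diag !mxE eqxx /=.
  by case: eqP => [->|_]; rewrite ?(mulr1, mul1r) ?(mulr0, mul0r).
exact: orth_row_neq0.
Qed.

(** The symmetric matrix [P] on the right fixes the rows of the eigenspace [E]
    and has all its rows in [E]. Hence [1 - P] has its rows in the orthogonal
    complement of [E], and the two properties that characterize the projection
    onto [E] along this complement give [proj = P proj + (1 - P) proj = P]. *)
Lemma eigproj_orth_diag (R : realType) (n : nat) (Q : 'M[R]_n)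
    (d : 'rV[R]_n) (mu : R) : Q *m Q^T = 1%:M ->
  eigproj (Q^T *m diag_mx d *m Q) mu
  = Q^T *m diag_mx (\row_i (d 0 i == mu)%:R) *m Q.
Proof.
move=> QQ; have QTQ : Q^T *m Q = 1%:M by exact: mulmx1C.
set V := (X in eigproj X); set P := RHS; rewrite /eigproj.
set E := eigenspace V mu.
have PT : P^T = P by rewrite /P !trmx_mul tr_diag_mx trmxK mulmxA.
have PE : (P <= E)%MS.
  apply/eigenspaceP; rewrite /P /V !mulmxA -(mulmxA _ Q) QQ mulmx1.
  rewrite scalemxAl; congr (_ *m _); rewrite -!mulmxA scalemxAr.
  congr (_ *m _); apply/matrixP => i j; rewrite mul_diag_mx !mxE.
  case: (i == j); rewrite ?mulr0n ?mulr0// !mulr1n.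
  by case: eqP => [->|_]; rewrite ?(mulr1, mul1r) ?(mulr0, mul0r).
have EP m (x : 'M_(m, n)) : (x <= E)%MS -> x *m P = x.
  move=> /eigenspaceP xV; pose y := x *m Q^T.
  have yd : y *m diag_mx d = mu *: y.
    by rewrite /y scalemxAl -xV !mulmxA -(mulmxA _ Q) QQ mulmx1.
  rewrite /P !mulmxA -/y -[RHS]mulmx1 -QTQ [RHS]mulmxA -/y; congr (_ *m _).
  apply/matrixP => i j; have /matrixP/(_ i j) := yd.
  rewrite !mul_mx_diag !mxE mulrC; case: eqP => [_|dj]; first by rewrite mulr1.
  move=> /eqP; rewrite -subr_eq0 -mulrBl mulf_eq0 subr_eq0.
  by case: eqP => //= _ /eqP ->; rewrite mul0r.
have EEP : E *m P = E by exact: EP.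
have capE : (E :&: kermx E^T)%MS = 0.
  set W := (_ :&: _)%MS.
  have WP : W *m P = W by apply: EP; exact: capmxSl.
  have /sub_kermxP WE : (W <= kermx E^T)%MS by exact: capmxSr.
  have /submxP [Y PY] := PE.
  by rewrite -WP -PT PY trmx_mul mulmxA WE mul0mx.
have PcE : (1%:M - P <= kermx E^T)%MS.
  apply/sub_kermxP; rewrite mulmxBl mul1mx -{1}EEP trmx_mul PT subrr //.
rewrite -[LHS]mul1mx -[1%:M](subrK P) mulmxDl (proj_mx_0 capE PcE) add0r.
exact: proj_mx_id.
Qed.

(** * Sums over finite sets *)

Lemma morph_fsbig (V W : nmodType) (T : choiceType) (A : set T) (f : V -> W)
    (F : T -> V) : finite_set A -> f 0 = 0 -> {morph f : x y / x + y} ->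
  f (\sum_(x \in A) F x) = \sum_(x \in A) f (F x).
Proof.
by move=> finA f0 fD; rewrite !fsbig_finite// (big_morph f fD f0).
Qed.

Lemma fsbig_single (V : nmodType) (T : choiceType) (A : set T) (a : T)
    (F : T -> V) : A a -> (forall x, A x -> x != a -> F x = 0) ->
  \sum_(x \in A) F x = F a.
Proof.
move=> Aa F0; rewrite -(fsbig_widen [set a])//= ?fsbig_set1//.
  by move=> x ->.
by move=> x [Ax /eqP xa]; exact: F0.
Qed.

(** * The corotational operator as a Schur multiplier *)

Definition orthconj (R : realType) (n : nat) (Q X : 'M[R]_n) : 'M[R]_n :=
  Q *m X *m Q^T.

(** The Schur (Hadamard) multiplier: [X] is multiplied by [H] entry by entry. *)
Definition schur (R : realType) (n : nat) (H X : 'M[R]_n) : 'M[R]_n :=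
  map2_mx *%R H X.

(** For [i], [j] with equal eigenvalues, gbar is evaluated at [1], where it is
    [2] whatever [g] is: the entry is then the factor of [B D + D B] alone, so
    pairs excluded from the double sum need no special case. *)
Definition corot_mult (R : realType) (n : nat) (g : R -> R) (v : 'rV[R]_n) :
    'M[R]_n :=
  \matrix_(i, j) (v 0 j ^+ 2 * gbar g (v 0 i / v 0 j)).

(** In an orthonormal eigenbasis of [V], the projection [P_mu] is a 0/1 diagonal
    matrix, so the entry [(i, j)] of [P_mu D P_nu] survives only for
    [mu = v_i] and [nu = v_j]. The double sum thus contributes at most one term
    to each entry, and that entry of [D] gets multiplied by
    [v_i^2 + v_j^2 + g(v_i/v_j) (v_i^2 - v_j^2)], which is
    [v_j^2 gbar(v_i/v_j)]. *)
Lemma corot_orth_diag (R : realType) (n : nat) (g : R -> R) (B Q : 'M[R]_n)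
    (v : 'rV[R]_n) : Q *m Q^T = 1%:M -> (forall i, 0 < v 0 i) ->
  sqrtmx B = Q^T *m diag_mx v *m Q -> B = sqrtmx B *m sqrtmx B ->
  forall D, orthconj Q (corot g B D) = schur (corot_mult g v) (orthconj Q D).
Proof.
move=> QQ v0 VE BE D; have QTQ : Q^T *m Q = 1%:M by exact: mulmx1C.
have specE mu : spec (sqrtmx B) mu <-> exists i, v 0 i = mu.
  by rewrite VE; exact: eigenvalue_orth_diag.
have finS : finite_set (spec (sqrtmx B)).
  apply: (@sub_finite_set _ _ [set v 0 i | i in [set: 'I_n]]).
    by move=> mu /specE [i <-]; exists i.
  exact: finite_image.
have QBQ : Q *m B *m Q^T = diag_mx (\row_i (v 0 i ^+ 2)).
  rewrite BE VE !mulmxA QQ mul1mx -!(mulmxA _ Q) QQ !mulmx1 mulmx_diag.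
  by congr diag_mx; apply/rowP => i; rewrite !mxE expr2.
pose D' := Q *m D *m Q^T.
have conjM X Y : Q *m (X *m Y) *m Q^T = (Q *m X *m Q^T) *m (Q *m Y *m Q^T).
  by rewrite !mulmxA -(mulmxA _ Q^T) QTQ mulmx1.
have PDP mu nu i j :
    (Q *m (eigproj (sqrtmx B) mu *m D *m eigproj (sqrtmx B) nu) *m Q^T) i j
    = (v 0 i == mu)%:R * D' i j * (v 0 j == nu)%:R.
  have conjP x : Q *m eigproj (sqrtmx B) x *m Q^T
      = diag_mx (\row_i (v 0 i == x)%:R).
    by rewrite VE eigproj_orth_diag// !mulmxA QQ mul1mx -mulmxA QQ mulmx1.
  by rewrite !conjM !conjP mul_mx_diag mul_diag_mx !mxE.
apply/matrixP => i j; rewrite /orthconj /corot /=.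
(* Taking one entry in the eigenbasis is linear, so it goes through the sums. *)
pose f (X : 'M_n) := (Q *m X *m Q^T) i j.
have f0 : f 0 = 0 by rewrite /f mulmx0 mul0mx mxE.
have fD : {morph f : x y / x + y}.
  by move=> X Y; rewrite /f mulmxDr mulmxDl mxE.
have fZ a X : f (a *: X) = a * f X.
  by rewrite /f -scalemxAr -scalemxAl mxE.
rewrite -/(f _) !fD morph_fsbig//.
under eq_fsbigr => mu _.
  rewrite morph_fsbig//; last exact: finite_setD.
  under eq_fsbigr => nu _ do rewrite fZ {1}/f PDP.
  over.
rewrite (@fsbig_single _ _ _ (v 0 i)) /=; last 2 first.
- by apply/specE; exists i.
- move=> mu _ mui; apply: fsbig1 => nu _.
  by rewrite eq_sym (negbTE mui) !mul0r mulr0.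
have -> : f (B *m D) = v 0 i ^+ 2 * D' i j.
  by rewrite /f conjM QBQ mul_diag_mx !mxE.
have -> : f (D *m B) = v 0 j ^+ 2 * D' i j.
  by rewrite /f conjM QBQ mul_mx_diag !mxE mulrC.
rewrite !mxE -/D' /gbar eqxx.
have vj : v 0 j != 0 by rewrite gt_eqF.
have [vij|vij] := eqVneq (v 0 i) (v 0 j).
  rewrite fsbig1 ?vij ?divff//; last first.
    move=> nu [_ /eqP/negbTE]; rewrite eq_sym => ->.
    by rewrite mulr0 mulr0.
  by ring.
rewrite (@fsbig_single _ _ _ (v 0 j)); last 2 first.
- by split; [apply/specE; exists j | move=> /= vji; rewrite vji eqxx in vij].
- by move=> nu _ nuj; rewrite eq_sym (negbTE nuj) !mulr0.
by rewrite eqxx mulr1n; field.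
Qed.

(** * Positive definite matrices and their square root *)

Lemma orth_diag_SymPD (R : realType) (n : nat) (Q : 'M[R]_n) (v : 'rV[R]_n) :
  Q *m Q^T = 1%:M -> (forall i, 0 < v 0 i) -> SymPD (Q^T *m diag_mx v *m Q).
Proof.
move=> QQ v0; split=> [|x x0].
  by rewrite /Sym /= !trmx_mul trmxK tr_diag_mx mulmxA.
pose y := Q *m x.
have y0 : y != 0.
  apply: contra x0 => /eqP y0.
  by rewrite -[x]mul1mx -(mulmx1C QQ) -mulmxA -/y y0 mulmx0.
have -> : x^T *m (Q^T *m diag_mx v *m Q) *m x = y^T *m diag_mx v *m y.
  by rewrite /y trmx_mul !mulmxA.
have sumE : (y^T *m diag_mx v *m y) 0 0 = \sum_k v 0 k * y k 0 ^+ 2.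
  rewrite mul_mx_diag mxE; apply: eq_bigr => k _.
  by rewrite [_ 0 k]mxE [_ 0 k]mxE; ring.
have ge0 k : true -> 0 <= v 0 k * y k 0 ^+ 2.
  by move=> _; rewrite mulr_ge0 ?sqr_ge0 ?ltW.
rewrite sumE lt0r sumr_ge0 ?andbT//.
apply: contra y0; rewrite psumr_eq0// => /allP h.
apply/eqP/colP => k; rewrite [RHS]mxE.
have := h k (mem_index_enum k).
by rewrite /= mulf_eq0 gt_eqF//= sqrf_eq0 => /eqP.
Qed.

Lemma SymPD_orth_diag (R : realType) (n : nat) (A : 'M[R]_n) :
  SymPD A -> exists (Q : 'M[R]_n) (v : 'rV[R]_n),
    [/\ Q *m Q^T = 1%:M, forall i, 0 < v 0 i & A = Q^T *m diag_mx v *m Q].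
Proof.
move=> [/symmetric_diag[Q [v [QQ AE]]] pA]; exists Q, v; split=> // i.
have := pA (row i Q)^T; rewrite trmx_eq0 orth_row_neq0// => /(_ isT).
have -> : ((row i Q)^T^T *m A *m (row i Q)^T) 0 0 = (Q *m A *m Q^T) i i.
  rewrite trmxK -row_mul !mulmx_trE; apply: eq_bigr => k _.
  by rewrite [row _ _ _ _]mxE [X in _ * X]mxE.
by rewrite AE !mulmxA QQ mul1mx -mulmxA QQ mulmx1 mxE eqxx.
Qed.

Lemma sqrtmxP (R : realType) (n : nat) (B : 'M[R]_n) :
  SymPD B -> SymPD (sqrtmx B) /\ sqrtmx B *m sqrtmx B = B.
Proof.
move=> /SymPD_orth_diag[Q [b [QQ b0 BE]]].
pose v := \row_i Num.sqrt (b 0 i).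
apply: (@xgetPex _ 0 [set V | SymPD V /\ V *m V = B]).
exists (Q^T *m diag_mx v *m Q); split.
  by apply: orth_diag_SymPD => // i; rewrite mxE sqrtr_gt0.
rewrite BE !mulmxA -(mulmxA _ Q) QQ mulmx1; congr (_ *m _).
rewrite -!mulmxA mulmx_diag; congr (_ *m diag_mx _).
by apply/rowP => i; rewrite !mxE -expr2 sqr_sqrtr// ltW.
Qed.

Lemma corot_spectral (R : realType) (n : nat) (g : R -> R) (B : 'M[R]_n) :
  SymPD B -> exists (Q : 'M[R]_n) (v : 'rV[R]_n),
    [/\ Q *m Q^T = 1%:M, forall i, 0 < v 0 i,
        B = Q^T *m diag_mx (\row_i (v 0 i ^+ 2)) *m Q
      & forall D, orthconj Q (corot g B D)
          = schur (corot_mult g v) (orthconj Q D)].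
Proof.
move=> /sqrtmxP[/SymPD_orth_diag[Q [v [QQ v0 VE]]] BE].
exists Q, v; split=> //; last by apply: corot_orth_diag.
rewrite -{1}BE VE !mulmxA -(mulmxA _ Q) QQ mulmx1; congr (_ *m _).
by rewrite -!mulmxA mulmx_diag.
Qed.

(** From [g(1/Z) = - g(Z)] one gets [gbar(1/Z) = gbar(Z) / Z^2], and the factor
    [v_j^2] absorbs the denominator. *)
Lemma corot_mult_sym (R : realType) (n : nat) (g : R -> R) (v : 'rV[R]_n) :
  (forall Z : R, 0 < Z -> g Z^-1 = - g Z) -> (forall i, 0 < v 0 i) ->
  (corot_mult g v)^T = corot_mult g v.
Proof.
move=> hg v0; apply/matrixP => i j; rewrite !mxE /gbar.
rewrite -[v 0 j / v 0 i]invf_div hg ?divr_gt0//.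
have vi : v 0 i != 0 by rewrite gt_eqF.
have vj : v 0 j != 0 by rewrite gt_eqF.
by field; rewrite vi vj.
Qed.

(** * Orthogonal conjugation as an isometry of the symmetric matrices *)

Lemma innerE (R : realType) (n : nat) (X Y : 'M[R]_n) :
  inner X Y = \sum_i \sum_j X i j * Y i j.
Proof. by apply: eq_bigr => i _; rewrite mulmx_trE. Qed.

Lemma inner_orth (R : realType) (n : nat) (Q X Y : 'M[R]_n) :
  Q *m Q^T = 1%:M -> inner (orthconj Q X) (orthconj Q Y) = inner X Y.
Proof.
move=> /mulmx1C QTQ; rewrite /inner /orthconj !trmx_mul trmxK !mulmxA.
by rewrite -(mulmxA _ Q^T) QTQ mulmx1 -!mulmxA mxtrace_mulC -!mulmxA QTQ mulmx1.
Qed.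

Lemma orthconjK (R : realType) (n : nat) (Q : 'M[R]_n) :
  Q *m Q^T = 1%:M -> cancel (orthconj Q) (orthconj Q^T).
Proof.
move=> /mulmx1C QTQ X.
by rewrite /orthconj trmxK !mulmxA QTQ mul1mx -mulmxA QTQ mulmx1.
Qed.

Lemma orthconjKV (R : realType) (n : nat) (Q : 'M[R]_n) :
  Q *m Q^T = 1%:M -> cancel (orthconj Q^T) (orthconj Q).
Proof.
by move=> QQ X; rewrite -{1}[Q]trmxK orthconjK// trmxK; exact: mulmx1C.
Qed.

Lemma orthconj_Sym (R : realType) (n : nat) (Q X : 'M[R]_n) :
  Sym X -> Sym (orthconj Q X).
Proof.
by rewrite /Sym /orthconj /= => XT; rewrite !trmx_mul trmxK XT mulmxA.
Qed.

Lemma orthconj_neq0 (R : realType) (n : nat) (Q X : 'M[R]_n) :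
  Q *m Q^T = 1%:M -> X != 0 -> orthconj Q X != 0.
Proof.
move=> QQ; apply: contra => /eqP QX.
by rewrite -(orthconjK QQ X) QX /orthconj mulmx0 mul0mx.
Qed.

Lemma set_bij_orthconj (R : realType) (n : nat) (Q : 'M[R]_n)
    (f h : 'M[R]_n -> 'M[R]_n) :
  Q *m Q^T = 1%:M -> (forall D, orthconj Q (f D) = h (orthconj Q D)) ->
  set_bij (@Sym R n) (@Sym R n) h -> set_bij (@Sym R n) (@Sym R n) f.
Proof.
move=> QQ fh [hS hI hO].
have fE D : f D = orthconj Q^T (h (orthconj Q D)) by rewrite -fh orthconjK.
split.
- by move=> D SD /=; rewrite fE; apply/orthconj_Sym/hS/orthconj_Sym.
- move=> X Y /set_mem SX /set_mem SY fXY; apply: (can_inj (orthconjK QQ)).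
  apply: hI; rewrite -?fh ?fXY//; apply/mem_set; exact: orthconj_Sym.
- move=> Y SY; have [X SX hX] := hO _ (orthconj_Sym Q SY).
  exists (orthconj Q^T X); first exact: orthconj_Sym.
  by rewrite fE orthconjKV// hX orthconjK.
Qed.

(** * Positivity and bijectivity of a Schur multiplier *)

Lemma inner_schur_gt0 (R : realType) (n : nat) (H D : 'M[R]_n) :
  (forall i j, 0 < H i j) -> D != 0 -> 0 < inner (schur H D) D.
Proof.
move=> H0 D0; rewrite innerE.
have ge0 i j : true -> 0 <= schur H D i j * D i j.
  by rewrite mxE -mulrA -expr2 mulr_ge0 ?sqr_ge0 ?ltW.
have sge0 i : true -> 0 <= \sum_j schur H D i j * D i j.
  by move=> _; apply: sumr_ge0 => j; exact: ge0.
rewrite lt0r sumr_ge0// andbT.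
apply: contra D0; rewrite psumr_eq0// => /allP h.
apply/eqP/matrixP => i j; have := h i (mem_index_enum i) => /=.
rewrite psumr_eq0 => [/allP/(_ j (mem_index_enum j)) /=|k]; last exact: ge0.
by rewrite !mxE -mulrA mulf_eq0 gt_eqF//= mulf_eq0 orbb => /eqP.
Qed.

(** The matrices [e_ij + e_ji] are eigenvectors of a symmetric Schur multiplier;
    testing on them isolates one coefficient. *)
Lemma schur_test (R : realType) (n : nat) (H : 'M[R]_n) i j :
  H^T = H -> exists E : 'M[R]_n, [/\ Sym E, E != 0 & schur H E = H i j *: E].
Proof.
move=> symH; exists (delta_mx i j + delta_mx j i); split.
- by rewrite /Sym /= linearD /= !trmx_delta addrC.
- apply/eqP => /matrixP/(_ i j); rewrite !mxE !eqxx /= => /eqP.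
  by rewrite gt_eqF// ltr_pwDl// ler0n.
- have symE k l : H k l = H l k by rewrite -{1}symH mxE.
  apply/matrixP => k l; rewrite !mxE !mulrDr.
  congr (_ + _); case: andP => [[/eqP -> /eqP ->]|]; rewrite ?mulr0//.
  by rewrite symE.
Qed.

Lemma schur_pos (R : realType) (n : nat) (H : 'M[R]_n) : H^T = H ->
  (forall D, Sym D -> D != 0 -> 0 < inner (schur H D) D)
  <-> (forall i j, 0 < H i j).
Proof.
move=> symH; split=> [Hpos i j|H0 D _]; last exact: inner_schur_gt0.
have [E [SE E0 HE]] := schur_test i j symH.
have := Hpos E SE E0; rewrite HE /inner -scalemxAl linearZ /= pmulr_lgt0//.
(* [schur (const_mx 1)] is the identity: the norm of [E] is positive as well. *)
have -> : \tr (E *m E^T) = inner (schur (const_mx 1) E) E.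
  congr (\tr (_ *m _)); apply/matrixP => k l; rewrite !mxE mul1r //.
by apply: inner_schur_gt0 => // k l; rewrite mxE ltr01.
Qed.

Lemma schur_bij (R : realType) (n : nat) (H : 'M[R]_n) : H^T = H ->
  set_bij (@Sym R n) (@Sym R n) (schur H) <-> (forall i j, H i j != 0).
Proof.
move=> symH; split=> [[_ injH _] i j|H0].
  have [E [SE E0 HE]] := schur_test i j symH.
  apply: contra_neq E0 => Hij; apply: injH.
  - exact/mem_set.
  - by apply/mem_set; rewrite /Sym /= trmx0.
  - by rewrite HE Hij scale0r; apply/matrixP => k l; rewrite !mxE mulr0.
have symHE k l : H k l = H l k by rewrite -{1}symH mxE.
split.
- move=> D SD; apply/matrixP => k l; rewrite !mxE symHE; congr (_ * _).
  by rewrite -[in RHS]SD mxE.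
- move=> X Y _ _ /matrixP hXY; apply/matrixP => k l.
  by have := hXY k l; rewrite !mxE => /(mulfI (H0 k l)).
- move=> Y SY; exists (\matrix_(k, l) (Y k l / H k l)).
    apply/matrixP => k l; rewrite !mxE symHE; congr (_ / _).
    by rewrite -[in RHS]SY mxE.
  by apply/matrixP => k l; rewrite !mxE mulrC divfK.
Qed.

(** * Realizing every quotient of eigenvalues, and conclusion *)

(** [B] is [diag(Z^2, 1, 1)]. Its square root enters only through some
    diagonalization [v], which is not explicit; but the [v_i^2] are the eigenvalues
    of [B] and [v_i > 0], so both [Z] and [1] are among the [v_i]. *)
Lemma corot_spectral_ratio (R : realType) (g : R -> R) (Z : R) : 0 < Z ->
  exists (B Q : 'M[R]_3) (v : 'rV[R]_3) (i j : 'I_3),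
    [/\ SymPD B, Q *m Q^T = 1%:M, forall i, 0 < v 0 i,
        forall D, orthconj Q (corot g B D)
          = schur (corot_mult g v) (orthconj Q D)
      & corot_mult g v i j = gbar g Z].
Proof.
move=> Z0; pose b : 'rV[R]_3 := \row_i (if i == 0 then Z ^+ 2 else 1).
have I1 : (1%:M : 'M[R]_3) *m 1%:M^T = 1%:M by rewrite trmx1 mulmx1.
pose B := 1%:M^T *m diag_mx b *m 1%:M.
have SB : SymPD B.
  by apply: orth_diag_SymPD => // i; rewrite mxE; case: eqP; rewrite ?exprn_gt0.
have [Q [v [QQ v0 BE corE]]] := corot_spectral g SB.
have ev x (x0 : 0 < x) k : b 0 k = x ^+ 2 -> exists i, v 0 i = x.
  move=> bk; have := (eigenvalue_orth_diag b (x ^+ 2) I1).2 (ex_intro _ k bk).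
  rewrite -/B BE => Bx.
  have [l] := (eigenvalue_orth_diag _ _ QQ).1 Bx; rewrite mxE => vl.
  exists l; apply/eqP; rewrite -(@eqrXn2 _ 2) ?vl// ltW //.
have [i vi] : exists i, v 0 i = Z by apply: (ev Z Z0 0); rewrite mxE.
have [j vj] : exists i, v 0 i = 1.
  by apply: (ev 1 ltr01 1); rewrite mxE expr1n.
exists B, Q, v, i, j; split=> //.
by rewrite mxE vi vj expr1n mul1r divr1.
Qed.

Theorem mainTheorem2 (R : realType) (g : R -> R)
    (hg : forall Z : R, 0 < Z -> g Z^-1 = - g Z) :
  ((forall B D : 'M[R]_3, SymPD B -> Sym D -> D != 0 ->
      0 < inner (corot g B D) D)
   <-> (forall Z : R, 0 < Z -> 0 < gbar g Z))
  /\
  ((forall B : 'M[R]_3, SymPD B ->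
      set_bij (@Sym R 3) (@Sym R 3) (corot g B))
   <-> (forall Z : R, 0 < Z -> gbar g Z != 0)).
Proof.
split; split.
- move=> pos Z Z0.
  have [B [Q [v [i [j [SB QQ v0 corE <-]]]]]] := corot_spectral_ratio g Z0.
  apply: (schur_pos (corot_mult_sym hg v0)).1 => D SD D0.
  have QQt : Q^T *m Q^T^T = 1%:M by rewrite trmxK; exact: mulmx1C.
  rewrite -(orthconjKV QQ D) -corE inner_orth//.
  by apply: pos => //; [exact: orthconj_Sym | exact: orthconj_neq0].
- move=> gpos B D SB SD D0; have [Q [v [QQ v0 _ corE]]] := corot_spectral g SB.
  rewrite -(inner_orth _ _ QQ) corE; apply: inner_schur_gt0.
    by move=> i j; rewrite mxE mulr_gt0 ?exprn_gt0// gpos ?divr_gt0.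
  exact: orthconj_neq0.
- move=> bij Z Z0.
  have [B [Q [v [i [j [SB QQ v0 corE <-]]]]]] := corot_spectral_ratio g Z0.
  apply: (schur_bij (corot_mult_sym hg v0)).1.
  apply: (set_bij_orthconj (Q := Q^T) (h := corot g B)); last exact: bij.
    by rewrite trmxK; exact: mulmx1C.
  by move=> D; rewrite -{1}(orthconjKV QQ D) -corE orthconjK.
- move=> gneq0 B SB; have [Q [v [QQ v0 _ corE]]] := corot_spectral g SB.
  apply: (set_bij_orthconj QQ corE).
  apply/(schur_bij (corot_mult_sym hg v0)) => i j.
  by rewrite mxE mulf_neq0 ?expf_neq0 ?gneq0 ?divr_gt0// gt_eqF.
Qed.
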